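(* Suppose $C_0(\Sigma)=[\xi,\eta]$ and $a<\xi$. Let $n\ge1$ and, for $N\ge0$, let $x_{n,1}^N=x_{n,1}^N(a)$ be the smallest zero of $p_n^N(a;x)$. Put $$N_0=N_0(n,a,\xi)=\frac{-p_n(\xi)}{K_{n-1}(a,a)\,(\xi-a)\,p_{n-1}^{**}(a;\xi)}.$$ Then $N_0>0$ and $$x_{n,1}^N>\xi\ \text{ for } N<N_0,\qquad x_{n,1}^N=\xi\ \text{ for } N=N_0,\qquad x_{n,1}^N<\xi\ \text{ for } N>N_0.$$
   Context: $\mu$ is a positive Borel measure on $\mathbb R$ whose support $\Sigma$ has infinitely many points, with all moments finite. $C_0(\Sigma)$ is the convex hull of $\Sigma$. $\{p_n(x)\}_{n\ge0}$ is the sequence of monic orthogonal polynomials for $\mu$, with $\|p\|_\mu^2=\int p^2d\mu$, and $K_n(x,y)=\sum_{j=0}^n p_j(x)p_j(y)/\|p_j\|_\mu^2$. $\{p_n^{**}(a;x)\}_{n\ge0}$ is the sequence of monic orthogonal polynomials for $(x-a)^2d\mu(x)$. $\{p_n^{N}(a;x)\}_{n\ge0}$ is the sequence of monic orthogonal polynomials for $d\mu+N\delta_a$, with $\delta_a$ the unit point mass at $a$. *)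

(* Defs.v *)
From HB Require Import structures.
From mathcomp Require Import all_boot all_order all_algebra.
From mathcomp Require Import all_classical all_reals all_analysis measurable_realfun.

Set Implicit Arguments.
Unset Strict Implicit.
Unset Printing Implicit Defensive.

Import Order.TTheory GRing.Theory Num.Theory.
Import numFieldNormedType.Exports.

Local Open Scope classical_set_scope.
Local Open Scope ring_scope.

(* [measurableTypeR R] is the real line with its Borel sigma-algebra. *)
Notation borel_measure R := {measure set (measurableTypeR R) -> \bar R}
  (R in scope type_scope).

Definition msupport (R : realType) (mu : borel_measure R) : set R :=
  [set x | forall U : set R, open_nbhs x U -> (0 < mu U)%E].

(* [R^o] is R as a vector space over itself, on which [convex_set] is stated. *)
Definition convex_hull (R : realType) (A : set R) : set R :=
  smallest (@convex_set R R^o) A.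

Definition finite_moments (R : realType) (mu : borel_measure R) : Prop :=
  forall k : nat, mu.-integrable setT (fun x : R => (x ^+ k)%:E).

Definition inner (R : realType) (mu : borel_measure R) (p q : {poly R}) : R :=
  \int[mu]_(x in setT) (p.[x] * q.[x]).

Definition sqnorm (R : realType) (mu : borel_measure R) (p : {poly R}) : R :=
  inner mu p p.

Definition monic_orthogonal (R : realType) (mu : borel_measure R)
    (p : nat -> {poly R}) : Prop :=
  [/\ forall n, p n \is monic,
      forall n, size (p n) = n.+1
    & forall m n, m != n -> inner mu (p m) (p n) = 0].

Definition cd_kernel (R : realType) (mu : borel_measure R)
    (p : nat -> {poly R}) (n : nat) (x y : R) : R :=
  \sum_(j < n.+1) (p j).[x] * (p j).[y] / sqnorm mu (p j).

(* The measure (x - a)^2 dmu(x). *)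
Definition christoffel (R : realType) (mu : borel_measure R) (a : R)
    (A : set (measurableTypeR R)) : \bar R :=
  (\int[mu]_(x in A) ((x - a) ^+ 2)%:E)%E.

Section christoffel_measure.
Context (R : realType) (mu : borel_measure R) (a : R).

Let christoffel0 : christoffel mu a set0 = 0%E.
Proof. by rewrite /christoffel integral_set0. Qed.

Let christoffel_ge0 A : (0 <= christoffel mu a A)%E.
Proof. by apply: integral_ge0 => x _; rewrite lee_fin sqr_ge0. Qed.

Let christoffel_sigma_additive : semi_sigma_additive (christoffel mu a).
Proof.
apply: semi_sigma_additive_nng_induced => [|x]; last first.
  by rewrite lee_fin sqr_ge0.
apply/measurable_EFinP; apply: measurable_funX.
exact: measurable_funB.
Qed.

HB.instance Definition _ := isMeasure.Build _ _ _ (christoffel mu a)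
  christoffel0 christoffel_ge0 christoffel_sigma_additive.

End christoffel_measure.

(* The measure dmu + N delta_a. *)
Definition uvarov (R : realType) (mu : borel_measure R) (a : R)
    (N : {nonneg R}) : borel_measure R :=
  measure_add mu (mscale N (@dirac _ (measurableTypeR R) a R)).

Definition smallest_zero (R : realType) (p : {poly R}) (x : R) : Prop :=
  root p x /\ forall y, root p y -> x <= y.

(* Main.v *)
Require Import Defs.
From HB Require Import structures.
From mathcomp Require Import all_boot all_order all_algebra.
From mathcomp Require Import all_classical all_reals all_analysis.
From mathcomp Require Import measurable_realfun polyrcf ring.

Set Implicit Arguments.
Unset Strict Implicit.
Unset Printing Implicit Defensive.

Import Order.TTheory GRing.Theory Num.Theory.
Import numFieldNormedType.Exports.

Local Open Scope classical_set_scope.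
Local Open Scope ring_scope.

(** Write [n.+1] for the degree, [K] for the kernel K_n(a,a), [D] for
    (X - a) p_n^{**}, and [Q] for the monic orthogonal polynomial p_{n+1}^N of
    mu + N delta_a.  The proof rests on the connection formula

      (1 + N K) Q = p_{n+1} + N K D          ([uvarov_orthogonalE]).

    The polynomial D is orthogonal in mu to every polynomial of degree at most
    n that vanishes at a, so on degree at most n the functional f |-> int D f
    is a multiple of f |-> f(a); testing against the reproducing kernel
    K_n(., a) gives that multiple as - p_{n+1}(a) / K.  This is exactly what
    cancels the contribution N p_{n+1}(a) f(a) of the point mass, so the
    right-hand side is orthogonal for mu + N delta_a, and such a polynomial is
    determined by its leading coefficient.

    Evaluated at xi, the formula makes (-1)^(n+1) Q(xi) a positive multiple of
    A - N B, where A = (-1)^(n+1) p_{n+1}(xi) and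
    B = (-1)^n K (xi - a) p_n^{**}(xi).  Both are positive because all zeros of
    p_{n+1} and p_n^{**} lie to the right of xi, and N_0 = A / B.  It remains
    to read the position of the smallest zero from the sign at xi.  If
    N > N_0, the sign at xi differs from the sign at - oo, hence a zero lies
    to the left of xi.  Otherwise the decisive fact is that Q has at most one
    zero in (-oo, xi], counted with multiplicity
    ([uvarov_no_two_roots_le]): for N = N_0 that zero is xi itself, and for
    N < N_0 a zero there would leave a cofactor with the wrong sign at xi and
    so force a second one.

    Everything above uses only a linear functional on polynomials that is
    positive on nonzero polynomials nonnegative on [xi, +oo).  Integration
    against mu is one because mu is carried by its support, which lies in
    [xi, +oo) and is too large to consist of zeros of one polynomial
    ([moment_functional_gt0]). *)

(** * Signs of monic polynomials *)

(** At - oo a monic polynomial of degree n has the sign (-1)^n, so the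
    intermediate value theorem applies. *)
Lemma monic_root_lt (R : rcfType) (n : nat) (P : {poly R}) (c : R) :
  P \is monic -> size P = n.+1 -> (-1) ^+ n * P.[c] < 0 ->
  exists2 y, y < c & root P y.
Proof.
move=> Pm Ps Pc.
(* The reflection turns the behaviour at - oo into that at + oo. *)
pose Q := (-1) ^+ n *: (P \Po - 'X).
have QE x : Q.[x] = (-1) ^+ n * P.[- x].
  by rewrite hornerZ horner_comp hornerN hornerX.
have lQ : lead_coef Q = 1.
  rewrite lead_coefZ lead_coef_comp ?size_polyN ?size_polyX//.
  rewrite lead_coefN lead_coefX (monicP Pm) Ps mul1r /=.
  by rewrite -exprMn mulrNN mulr1 expr1n.
have [|b bP] := @poly_pinfty_gt_lc R Q; first by rewrite lQ ltr01.
pose d := Num.max b (- c).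
have Qd : 0 < Q.[d] by rewrite (lt_le_trans ltr01)// -lQ bP// le_max lexx.
have Qc : Q.[- c] < 0 by rewrite QE opprK.
have [| |y /andP[yI _]] := @poly_ivt R Q (- c) d.
- by rewrite le_max lexx orbT.
- by rewrite !ltW.
rewrite /root QE mulf_eq0 signr_eq0 /= => /eqP y0.
exists (- y); last by rewrite /root y0.
rewrite ltrNl lt_neqAle yI andbT; apply: contraTneq Pc => cy.
by rewrite -[c]opprK cy y0 mulr0 ltxx.
Qed.

Lemma monic_sign_left (R : rcfType) n (P : {poly R}) (c : R) :
  P \is monic -> size P = n.+1 -> (forall y, root P y -> c < y) ->
  0 < (-1) ^+ n * P.[c].
Proof.
move=> Pm Ps Pc; rewrite lt_neqAle; apply/andP; split.
  rewrite eq_sym mulf_eq0 signr_eq0 /=; apply/negP => /eqP c0.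
  by have := Pc c; rewrite /root c0 eqxx ltxx => /(_ isT).
rewrite leNgt; apply/negP => /(monic_root_lt Pm Ps)[y yc /Pc].
by rewrite ltNge (ltW yc).
Qed.

(** * Orthogonality for a positive functional *)

Section functional.
Variable R : realFieldType.
Implicit Types (L : {scalar {poly R}}) (p pss : nat -> {poly R}).
Implicit Types (P Q f q : {poly R}).

Definition orthogonal_seq L p :=
  [/\ forall n, p n \is monic,
      forall n, size (p n) = n.+1
    & forall m n, m != n -> L (p m * p n) = 0].

(** Strictness on nonzero polynomials reflects that the measure behind L is not
    carried by finitely many points. *)
Definition positive_on_ray L (c : R) :=
  forall f, f != 0 -> (forall x, c <= x -> 0 <= f.[x]) -> 0 < L f.

Definition orthogonal_below L P :=
  forall q, (size q < size P)%N -> L (P * q) = 0.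

(** The members of degree less than n of a graded monic family span the
    polynomials of degree less than n. *)
Lemma graded_scalar_eq0 p (F : {poly R} -> R) n :
  scalar F -> (forall j, p j \is monic) -> (forall j, size (p j) = j.+1) ->
  (forall j, (j < n)%N -> F (p j) = 0) ->
  forall q, (size q <= n)%N -> F q = 0.
Proof.
move=> lF pm ps; elim: n => [|n IH] Fp q qn.
  have F0 : F 0 = 0.
    by have := lF (-1) 0 0; rewrite scaler0 addr0 mulN1r addNr.
  by move: qn; rewrite leqn0 size_poly_eq0 => /eqP->.
have -> : q = q`_n *: p n + (q - q`_n *: p n) by rewrite addrC subrK.
rewrite lF Fp// mulr0 add0r IH// => [j jn|]; first by rewrite Fp// ltnW.
apply/leq_sizeP => j; rewrite leq_eqVlt => /predU1P[<-|nj].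
  have := pm n; rewrite monicE /lead_coef ps /= => /eqP pn1.
  by rewrite coefB coefZ pn1 mulr1 subrr.
rewrite coefB coefZ [q`_j]nth_default ?(leq_trans qn)//.
by rewrite [(p n)`_j]nth_default ?ps// mulr0 subr0.
Qed.

Lemma orthogonal_seq_below L p n :
  orthogonal_seq L p -> orthogonal_below L (p n).
Proof.
move=> [pm ps po] q; rewrite ps ltnS.
apply: (graded_scalar_eq0 (F := fun q => L (p n * q))) (pm) (ps) _ q.
  by move=> c u v; rewrite mulrDr linearD -scalerAr linearZ.
by move=> j jn; rewrite po// gtn_eqF.
Qed.

Lemma positive_sqr L c f : positive_on_ray L c -> f != 0 -> 0 < L (f * f).
Proof.
move=> Lp f0; apply: Lp => [|x _]; first by rewrite mulf_neq0.
by rewrite hornerM -expr2 sqr_ge0.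
Qed.

Lemma positive_on_rayW L c d :
  d <= c -> positive_on_ray L c -> positive_on_ray L d.
Proof.
by move=> dc Lp f f0 fd; apply: Lp => // x cx; rewrite fd// (le_trans dc).
Qed.

Lemma sub_monic_size n P Q : P \is monic -> Q \is monic ->
  size P = n.+1 -> size Q = n.+1 -> (size (P - Q)%R <= n)%N.
Proof.
rewrite !monicE /lead_coef => + + sP sQ; rewrite sP sQ /= => /eqP Pn /eqP Qn.
apply/leq_sizeP => j; rewrite leq_eqVlt coefB => /predU1P[<-|nj].
  by rewrite Pn Qn subrr.
by rewrite !nth_default ?subrr ?sP ?sQ.
Qed.

Lemma root_factor P y : P != 0 -> root P y ->
  exists r, [/\ P = ('X - y%:P) * r, r != 0 & size P = (size r).+1].
Proof.
move=> P0 /factor_theorem[r Pr]; exists r.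
have r0 : r != 0 by apply: contraNneq P0 => r0; rewrite Pr r0 mul0r.
by split; rewrite // Pr ?size_Mmonic ?monicXsubC ?size_XsubC ?addn2// mulrC.
Qed.

(** With P = (X - y) r and y <= c, the product P r = (X - y) r^2 is nonnegative
    to the right of c, which contradicts the orthogonality of P and r. *)
Lemma orthogonal_below_root_gt L c P y : positive_on_ray L c ->
  P != 0 -> orthogonal_below L P -> root P y -> c < y.
Proof.
move=> Lp P0 Po /(root_factor P0)[r [Pr r0 sr]].
rewrite ltNge; apply/negP => yc.
suff : 0 < L (P * r) by rewrite Po ?ltxx// sr.
rewrite Pr; apply: Lp => [|x cx]; first by rewrite !mulf_neq0// polyXsubC_eq0.
rewrite !hornerM hornerXsubC -mulrA mulr_ge0 ?subr_ge0 ?(le_trans yc)//.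
by rewrite -expr2 sqr_ge0.
Qed.

(** * The connection formula *)

Definition christoffel_functional L (a : R) f : R := L (f * ('X - a%:P) ^+ 2).

Definition uvarov_functional L (a N : R) f : R := L f + N * f.[a].

Lemma christoffel_functional_scalar L a : scalar (christoffel_functional L a).
Proof.
by move=> k f g; rewrite /christoffel_functional mulrDl -scalerAl linearP.
Qed.

HB.instance Definition _ L a := @GRing.isLinear.Build R {poly R} R *%R
  (christoffel_functional L a) (christoffel_functional_scalar L a).

Lemma uvarov_functional_scalar L a N : scalar (uvarov_functional L a N).
Proof.
move=> k f g; rewrite /uvarov_functional linearP hornerD hornerZ /=; ring.
Qed.

HB.instance Definition _ L a N := @GRing.isLinear.Build R {poly R} R *%R
  (uvarov_functional L a N) (uvarov_functional_scalar L a N).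

Section christoffel_kernel.
Variables (L : {scalar {poly R}}) (p pss : nat -> {poly R}) (c a : R).
Hypothesis L_pos : positive_on_ray L c.
Hypothesis p_orth : orthogonal_seq L p.
Local Notation L' := (christoffel_functional L a).
Hypothesis pss_orth : orthogonal_seq L' pss.

Lemma christoffel_positive : positive_on_ray L' c.
Proof.
move=> f f0 fc; apply: L_pos => [|x cx].
  by rewrite mulf_neq0// expf_neq0// polyXsubC_eq0.
by rewrite hornerM mulr_ge0 ?fc// horner_exp sqr_ge0.
Qed.

(** The Christoffel-Darboux kernel K_n(., a). *)
Definition kernel_poly (n : nat) : {poly R} :=
  \sum_(j < n.+1) ((p j).[a] / L (p j * p j)) *: p j.

Lemma kernel_poly_gt0 n : 0 < (kernel_poly n).[a].
Proof.
have [pm ps _] := p_orth.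
have h j : 0 < L (p j * p j) by apply: positive_sqr L_pos _; exact: monic_neq0.
have p0 : p 0%N = 1.
  have := pm 0%N; have /eqP/size_poly1P[k _ ->] := ps 0%N.
  by rewrite monicE lead_coefC => /eqP->.
rewrite /kernel_poly horner_sum big_ord_recl ltr_wpDr//.
  apply: sumr_ge0 => j _; rewrite hornerZ mulrAC -expr2.
  by rewrite divr_ge0 ?sqr_ge0// ltW.
by rewrite hornerZ mulrAC divr_gt0 /= ?h// p0 hornerC mulr1 ltr01.
Qed.

(** The reproducing property; by linearity the p_j suffice. *)
Lemma kernel_polyP n q : (size q <= n.+1)%N -> L (kernel_poly n * q) = q.[a].
Proof.
have [pm ps po] := p_orth => qn; apply/eqP; rewrite -subr_eq0; apply/eqP.
pose F q := L (kernel_poly n * q) - q.[a].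
apply: (graded_scalar_eq0 (F := F)) (pm) (ps) _ q qn; rewrite /F.
  move=> k u v; rewrite mulrDr linearD -scalerAr linearZ hornerD hornerZ /=.
  ring.
move=> j jn; rewrite /kernel_poly mulr_suml linear_sum (bigD1 (Ordinal jn))//=.
rewrite big1 ?addr0 => [|i ij]; last first.
  by rewrite -scalerAl linearZ /= (po _ _ ij) mulr0.
rewrite -scalerAl linearZ /= divfK ?subrr// gt_eqF//.
by apply: positive_sqr L_pos _; exact: monic_neq0.
Qed.

(** Write q = q(a) + (X - a) r: the second part contributes the integral of
    p_n^{**} r against (x - a)^2 mu, which vanishes since r has degree less
    than n. *)
Lemma christoffel_orthogonal n q : (size q <= n.+1)%N ->
  L (('X - a%:P) * pss n * q) = q.[a] * L (('X - a%:P) * pss n).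
Proof.
move=> qn; have [_ pss_size _] := pss_orth.
have /factor_theorem[r qr] : root (q - q.[a]%:P) a.
  by rewrite /root !hornerE subrr.
have -> : q = q.[a]%:P + r * ('X - a%:P) by rewrite -qr addrC subrK.
rewrite !hornerE subrr mulr0 addr0.
rewrite mulrDr linearD [X in L X + _]mulrC mul_polyC linearZ /=.
suff -> : L (('X - a%:P) * pss n * (r * ('X - a%:P))) = 0 by rewrite addr0.
have -> : ('X - a%:P) * pss n * (r * ('X - a%:P))
    = pss n * r * ('X - a%:P) ^+ 2 by ring.
rewrite -[LHS]/(L' (pss n * r)); apply: (orthogonal_seq_below pss_orth).
have [->|r0] := eqVneq r 0; first by rewrite size_poly0 pss_size.
have : (size (q - q.[a]%:P)%R <= n.+1)%N.
  rewrite (leq_trans (size_polyD _ _))// geq_max qn size_polyN size_polyC.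
  by case: (_ != _).
by rewrite qr size_Mmonic ?monicXsubC// size_XsubC addn2 pss_size.
Qed.

Lemma christoffel_size n : size (('X - a%:P) * pss n) = n.+2.
Proof.
have [_ pss_size _] := pss_orth.
by rewrite size_monicM ?monicXsubC// -?size_poly_eq0 ?pss_size ?size_XsubC.
Qed.

Lemma christoffel_monic n : ('X - a%:P) * pss n \is monic.
Proof. by have [? _ _] := pss_orth; rewrite monicMl ?monicXsubC. Qed.

(** Both sides are L (K_n(., a) (X - a) p_n^{**}): the left one because only
    the value of the kernel at a counts, the right one because the reproducing
    property applies to the difference with p_{n+1}, of degree at most n. *)
Lemma kernel_christoffel n :
  (kernel_poly n).[a] * L (('X - a%:P) * pss n) = - (p n.+1).[a].
Proof.
have [pm ps po] := p_orth.
have kn : (size (kernel_poly n) <= n.+1)%N.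
  rewrite (leq_trans (size_sum _ _ _))//; apply/bigmax_leqP => j _.
  by rewrite (leq_trans (size_scale_leq _ _))// ps.
rewrite -christoffel_orthogonal//.
have -> : ('X - a%:P) * pss n * kernel_poly n
   = kernel_poly n * (('X - a%:P) * pss n - p n.+1) + p n.+1 * kernel_poly n.
  ring.
rewrite linearD (orthogonal_seq_below p_orth) ?ps// addr0 kernel_polyP.
  by rewrite !hornerE subrr mul0r add0r.
by rewrite sub_monic_size ?christoffel_monic ?christoffel_size.
Qed.

Section uvarov_polynomial.
Variable N : R.
Hypothesis a_lt_c : a < c.
Hypothesis N_ge0 : 0 <= N.
Local Notation M := (uvarov_functional L a N).

Lemma uvarov_positive : positive_on_ray M a.
Proof.
move=> f f0 fa; rewrite /uvarov_functional ltr_pwDl ?mulr_ge0 ?fa//.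
by apply: (positive_on_rayW (ltW a_lt_c) L_pos).
Qed.

(** The right-hand side is orthogonal for the perturbed functional to all lower
    degrees by [kernel_christoffel]; the difference of both sides has degree at
    most n, is orthogonal to itself, and so is 0. *)
Lemma uvarov_orthogonalE n Q : Q \is monic -> size Q = n.+2 ->
  orthogonal_below M Q ->
  (1 + N * (kernel_poly n).[a]) *: Q =
  p n.+1 + (N * (kernel_poly n).[a]) *: (('X - a%:P) * pss n).
Proof.
move=> Qm Qs Qo; have [pm ps po] := p_orth.
set K := (kernel_poly n).[a]; set D := ('X - a%:P) * pss n.
set W := p n.+1 + _; pose E := (1 + N * K) *: Q - W.
have Es : (size E <= n.+1)%N.
  have -> : E = (Q - p n.+1) + (N * K) *: (Q - D).
    by rewrite /E /W scalerDl scale1r scalerBr opprD addrACA.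
  rewrite (leq_trans (size_polyD _ _))// geq_max sub_monic_size//=.
  by rewrite (leq_trans (size_scale_leq _ _))// sub_monic_size
    ?christoffel_monic ?christoffel_size.
have Wo q : (size q <= n.+1)%N -> M (W * q) = 0.
  move=> qn; rewrite /uvarov_functional /W mulrDl linearD -scalerAl linearZ /=.
  rewrite (orthogonal_seq_below p_orth) ?ps// christoffel_orthogonal//.
  rewrite hornerD hornerZ !hornerM hornerXsubC subrr.
  have -> : (p n.+1).[a] = - (K * L D) by rewrite kernel_christoffel opprK.
  rewrite /D; ring.
apply/eqP; rewrite -subr_eq0 -/E; apply: contraT => E0.
have EE : M (E * E) = 0.
  have -> : E * E = (1 + N * K) *: (Q * E) - W * E.
    by rewrite {1}/E mulrBl -scalerAl.
  by rewrite linearB linearZ /= Wo// Qo ?Qs// mulr0 subr0.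
suff : 0 < M (E * E) by rewrite EE ltxx.
exact: positive_sqr uvarov_positive E0.
Qed.

(** Both zeros exceed a, so (x - y) (x - z) is nonnegative at the point mass as
    well as to the right of c.  Hence P = (X - y) (X - z) r cannot be orthogonal
    to r. *)
Lemma uvarov_no_two_roots_le P y z r : P != 0 -> orthogonal_below M P ->
  P = ('X - y%:P) * (('X - z%:P) * r) -> y <= c -> z <= c -> False.
Proof.
move=> P0 Po Pr yc zc.
have Pgt := orthogonal_below_root_gt uvarov_positive P0 Po.
have ay : a < y by apply: Pgt; rewrite Pr rootM root_XsubC eqxx.
have az : a < z by apply: Pgt; rewrite Pr !rootM !root_XsubC eqxx orbT.
have r0 : r != 0 by apply: contraNneq P0 => r0; rewrite Pr r0 !mulr0.
have rs : (size r < size P)%N.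
  rewrite Pr !size_monicM ?monicXsubC ?mulf_neq0 ?polyXsubC_eq0//.
  by rewrite !size_XsubC.
suff : 0 < M (P * r) by rewrite (Po _ rs) ltxx.
have PrE x : (P * r).[x] = (x - y) * (x - z) * r.[x] ^+ 2.
  rewrite Pr !hornerM !hornerXsubC; ring.
rewrite /uvarov_functional ltr_wpDr//.
  rewrite PrE mulr_ge0// mulr_ge0 ?sqr_ge0//.
  by rewrite mulr_le0 ?subr_le0 ?(ltW ay) ?(ltW az).
apply: L_pos => [|x cx]; first by rewrite mulf_neq0.
rewrite PrE mulr_ge0 ?sqr_ge0//.
by rewrite mulr_ge0 ?subr_ge0 ?(le_trans yc) ?(le_trans zc).
Qed.

End uvarov_polynomial.
End christoffel_kernel.
End functional.

(** * Position of the smallest zero *)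

Lemma uvarov_smallest_zero (R : realType) (L : {scalar {poly R}})
    (p pss : nat -> {poly R}) (c a : R) (n : nat) :
  positive_on_ray L c -> orthogonal_seq L p ->
  orthogonal_seq (christoffel_functional L a) pss -> a < c ->
  let N0 := - (p n.+1).[c] /
    ((kernel_poly L p a n).[a] * (c - a) * (pss n).[c]) in
  0 < N0 /\
  forall (N : R) (Q : {poly R}), 0 <= N -> Q \is monic -> size Q = n.+2 ->
  orthogonal_below (uvarov_functional L a N) Q ->
  forall x, smallest_zero Q x ->
    [/\ N < N0 -> c < x, N = N0 -> x = c & N0 < N -> x < c].
Proof.
move=> L_pos p_orth pss_orth ac Ncrit.
have [pm ps _] := p_orth; have [pssm psss _] := pss_orth.
set K := (kernel_poly L p a n).[a] in Ncrit *.
have K0 : 0 < K by exact: kernel_poly_gt0 L_pos p_orth n.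
pose A := (-1) ^+ n.+1 * (p n.+1).[c].
pose B := K * (c - a) * ((-1) ^+ n * (pss n).[c]).
have A0 : 0 < A.
  apply: monic_sign_left => // y.
  apply: (orthogonal_below_root_gt L_pos); first exact: monic_neq0.
  exact: orthogonal_seq_below.
have B0 : 0 < B.
  rewrite mulr_gt0 ?(mulr_gt0 K0) ?subr_gt0//; apply: monic_sign_left => // y.
  apply: (orthogonal_below_root_gt (@christoffel_positive _ L c a L_pos)).
    exact: monic_neq0.
  exact: orthogonal_seq_below.
have NcritE : Ncrit = A / B.
  have s0 : (-1) ^+ n != 0 :> R by rewrite signr_eq0.
  rewrite /Ncrit /A /B mulrCA exprS mulN1r mulNr -mulrN -mulf_div divff//.
  by rewrite mul1r.
split=> [|N Q N0 Qm Qs Qo x [Qx xmin]]; first by rewrite NcritE divr_gt0.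
have Q0 : Q != 0 by exact: monic_neq0.
have QcE : (-1) ^+ n.+1 * ((1 + N * K) * Q.[c]) = A - N * B.
  rewrite -hornerZ (uvarov_orthogonalE L_pos p_orth pss_orth ac N0)//.
  rewrite hornerD hornerZ hornerM hornerXsubC -/K /A /B exprS; ring.
have NK0 : 0 < 1 + N * K by rewrite ltr_pwDl// mulr_ge0// ltW.
have NAB : (N < Ncrit) = (0 < (-1) ^+ n.+1 * Q.[c]).
  by rewrite NcritE ltr_pdivlMr// -subr_gt0 -QcE mulrCA pmulr_rgt0.
have NBA : (Ncrit < N) = ((-1) ^+ n.+1 * Q.[c] < 0).
  by rewrite NcritE ltr_pdivrMr// -subr_lt0 -QcE mulrCA pmulr_rlt0.
have double := uvarov_no_two_roots_le L_pos ac N0 Q0 Qo.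
have [r [Qr r0 sr]] := root_factor Q0 Qx.
have rm : r \is monic by rewrite -(monicMl _ (monicXsubC x)) -Qr.
split.
- rewrite NAB => Qc; rewrite ltNge; apply/negP => xc.
  have rc : (-1) ^+ n * r.[c] < 0.
    have : (c - x) * ((-1) ^+ n * r.[c]) < 0.
      rewrite -oppr_gt0; move: Qc.
      by rewrite Qr hornerM hornerXsubC exprS mulN1r mulNr mulrCA.
    by apply: contraTT; rewrite -!leNgt => rc; rewrite mulr_ge0 ?subr_ge0.
  (* The sign of r at c differs from its sign at - oo, so r has a zero to the
     left of c, the second one of Q. *)
  have rs : size r = n.+1 by move: Qs; rewrite sr => -[].
  have [y yc ry] := monic_root_lt rm rs rc.
  have [s [rE _ _]] := root_factor r0 ry.
  by apply: (double x y s); rewrite -?rE// ltW.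
- move=> NE; have Qc : root Q c.
    rewrite /root; have H1 := ltxx N; rewrite {2}NE NAB in H1.
    have H2 := ltxx N; rewrite {1}NE NBA in H2.
    have : (-1) ^+ n.+1 * Q.[c] == 0 by rewrite eq_le !leNgt H1 H2.
    by rewrite mulf_eq0 signr_eq0.
  apply/eqP; rewrite eq_le (xmin _ Qc) leNgt; apply/negP => xc.
  have rc : root r c.
    by move: Qc; rewrite Qr rootM root_XsubC (gt_eqF xc).
  have [s [rs _ _]] := root_factor r0 rc.
  by apply: (double x c s); rewrite -?rs// ltW.
- rewrite NBA => /(monic_root_lt Qm Qs)[y yc /xmin xy].
  exact: le_lt_trans xy yc.
Qed.

(** * Integration against the modified measures *)

Section density.
Local Open Scope ereal_scope.
Context d (T : measurableType d) (R : realType).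
Variables (mu nu : {measure set T -> \bar R}) (g : T -> R).
Hypothesis g_ge0 : forall x, (0 <= g x)%R.
Hypothesis mg : measurable_fun setT g.
Hypothesis nuE : forall A, measurable A -> nu A = \int[mu]_(x in A) (g x)%:E.

Import HBNNSimple.

Let mge : measurable_fun setT (fun x => (g x)%:E).
Proof. exact/measurable_EFinP. Qed.

(** Fibre by fibre, the integral of a simple function reduces to [nuE]. *)
Lemma integral_density_nnsfun (h : {nnsfun T >-> R}) :
  \int[nu]_x (h x)%:E = \int[mu]_x ((h x)%:E * (g x)%:E).
Proof.
rewrite integralT_nnsfun sintegralE.
under [RHS]eq_integral => x _.
  rewrite fimfunE -fsumEFin// ge0_mule_fsuml => [|y]; last first.
    exact: nnfun_muleindic_ge0.
  over.
rewrite ge0_integral_fsum//; last 2 first.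
- move=> r; apply: emeasurable_funM => //; apply/measurable_EFinP.
  exact: measurable_funM.
- move=> r x _; rewrite mule_ge0//; last by rewrite lee_fin.
  exact: nnfun_muleindic_ge0.
apply: eq_fsbigr => r; rewrite inE => -[t _ <-].
under [RHS]eq_integral do rewrite EFinM -muleA muleC.
under [RHS]eq_integral do rewrite muleC.
rewrite ge0_integralZl_EFin//.
- rewrite nuE; last exact: measurable_sfunP.
  congr (_ * _); rewrite [LHS]integral_mkcond; apply: eq_integral => x _.
  by rewrite epatch_indic muleC.
- by move=> x _; rewrite mule_ge0 ?lee_fin.
- by apply: emeasurable_funM => //; apply/measurable_EFinP.
Qed.

Lemma ge0_integral_density (f : T -> \bar R) :
  measurable_fun setT f -> (forall x, 0 <= f x) ->
  \int[nu]_x f x = \int[mu]_x (f x * (g x)%:E).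
Proof.
move=> mf f0; pose h := nnsfun_approx measurableT mf.
have fE x : f x = lim ((h n x)%:E @[n --> \oo]).
  by apply/esym/cvg_lim => //; exact: cvg_nnsfun_approx.
have fgE x : f x * (g x)%:E = lim ((h n x)%:E * (g x)%:E @[n --> \oo]).
  apply/esym/cvg_lim => //; apply: cvgeZr => //; exact: cvg_nnsfun_approx.
under eq_integral do rewrite fE.
under [RHS]eq_integral do rewrite fgE.
rewrite !monotone_convergence//.
- by under eq_fun do rewrite integral_density_nnsfun.
- by move=> n; apply: emeasurable_funM => //; apply/measurable_EFinP.
- by move=> n x _; rewrite mule_ge0 ?lee_fin.
- move=> x _ m n mn; rewrite lee_wpmul2r ?lee_fin//.
  exact/lefP/nd_nnsfun_approx.
- by move=> n; apply/measurable_EFinP.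
- by move=> n x _; rewrite lee_fin.
- by move=> x _ m n mn; rewrite lee_fin; exact/lefP/nd_nnsfun_approx.
Qed.

(** Multiplication by the nonnegative weight g commutes with taking positive and
    negative parts, to which the nonnegative case applies. *)
Lemma integral_density (f : T -> R) : measurable_fun setT f ->
  \int[nu]_x (f x)%:E = \int[mu]_x (f x * g x)%:E.
Proof.
move=> mf; rewrite integralE [RHS]integralE.
have mfe : measurable_fun setT (EFin \o f) by exact/measurable_EFinP.
rewrite !ge0_integral_density//;
  [|exact: measurable_funeneg|exact: measurable_funepos].
congr (_ - _); apply: eq_integral => x _.
  by rewrite !funeposE EFinM maxe_pMl ?lee_fin// mul0e.
by rewrite !funenegE EFinM -mulNe maxe_pMl ?lee_fin// mul0e.
Qed.

End density.

Section moment_functional.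
Context (R : realType) (mu : borel_measure R).

Lemma Rintegral_christoffel (a : R) (f : R -> R) : measurable_fun setT f ->
  \int[christoffel mu a]_x f x = \int[mu]_x (f x * (x - a) ^+ 2).
Proof.
move=> mf; rewrite /Rintegral; congr fine.
apply: (@integral_density _ _ _ mu (christoffel mu a)
  (fun x => (x - a) ^+ 2)) => //.
- by move=> x; rewrite sqr_ge0.
- by apply: measurable_funX; exact: measurable_funB.
Qed.

Lemma Rintegral_uvarov (a : R) (N : {nonneg R}) (f : R -> R) :
  mu.-integrable setT (EFin \o f) ->
  \int[uvarov mu a N]_x f x = \int[mu]_x f x + N%:num * f a.
Proof.
move=> fi; have mf := measurable_int _ fi.
have ge0_uvarov (g : R -> \bar R) :
    measurable_fun (setT : set (measurableTypeR R)) g ->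
    (forall x, 0 <= g x)%E ->
    (\int[uvarov mu a N]_x g x = \int[mu]_x g x + N%:num%:E * g a)%E.
  move=> mg g0; rewrite /uvarov ge0_integral_measure_add//.
  by rewrite ge0_integral_mscale// integral_dirac// diracT mul1e.
rewrite /Rintegral -[N%:num * f a]/(fine (N%:num * f a)%:E) -fineD//; last first.
  exact: integrable_fin_num.
congr fine; rewrite integralE [in RHS]integralE.
rewrite !ge0_uvarov//; [|exact: measurable_funeneg|exact: measurable_funepos].
have /= fa := congr1 (fun h => h a) (funeposneg (EFin \o f)).
rewrite EFinM [in RHS]fa.
rewrite muleBr//; last exact: add_def_funeposneg.
rewrite addeACA oppeD// fin_num_adde_defr//.
by rewrite integrable_fin_num//; exact: integrable_funeneg.
Qed.

Hypothesis mu_moments : finite_moments mu.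

Lemma integrable_poly (f : {poly R}) :
  mu.-integrable setT (fun x : R => f.[x]%:E).
Proof.
rewrite (_ : (fun _ => _) =
    fun x : R => (\sum_(i < size f) (f`_i)%:E * (x ^+ i)%:E)%E); last first.
  by apply/funext => x; rewrite horner_coef -sumEFin.
by apply: integrable_sum => // i _; apply: integrableZl.
Qed.

(** The finiteness of the moments is an argument because linearity, registered
    on this constant, depends on it. *)
Definition moment_functional (_ : finite_moments mu) (f : {poly R}) : R :=
  \int[mu]_x f.[x].

Lemma moment_functional_scalar : scalar (moment_functional mu_moments).
Proof.
move=> c f g; rewrite /moment_functional -RintegralZl//; last first.
  exact: integrable_poly.
rewrite -RintegralD//; last exact: integrable_poly.
  by apply: eq_Rintegral => x _; rewrite hornerD hornerZ.
rewrite (_ : _ \o _ = fun x => (c *: f).[x]%:E); first exact: integrable_poly.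
by apply/funext => x /=; rewrite hornerZ.
Qed.

HB.instance Definition _ := @GRing.isLinear.Build R {poly R} R *%R
  (moment_functional mu_moments) moment_functional_scalar.

End moment_functional.

(** * Positivity of the integral *)

Section support.
Context (R : realType) (mu : borel_measure R).

(** Each point outside the support lies in a null ball with rational centre and
    radius, and there are countably many of those. *)
Lemma msupport_setC_negligible : mu.-negligible (~` msupport mu).
Proof.
pose B (cr : rat * rat) : set R := ball (ratr cr.1 : R) (ratr cr.2).
pose F k : set (measurableTypeR R) := if unpickle k is Some cr then
  (if mu (B cr) == 0%E then B cr else set0) else set0.
have mB cr : measurable (B cr : set (measurableTypeR R)).
  by apply: open_measurable; exact: ball_open.
apply: (@negligibleS _ _ _ mu (\bigcup_k F k)); last first.
  apply: negligible_bigcup => k; rewrite /F; case: unpickle => [cr|].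
    case: eqP => [B0|_]; last exact: negligible_set0.
    by exists (B cr); split.
  exact: negligible_set0.
move=> x /existsNP[U /not_implyP[[oU Ux] /negP]]; rewrite -leNgt => U0.
have [c [r /= [xB BU]]] := open_subball_rat oU (mem_set Ux).
have B0 : mu (B (c, r)) == 0%E.
  rewrite -measure_le0 (le_trans _ U0)//.
  by apply: le_measure => //; rewrite inE//; exact: open_measurable.
exists (pickle (c, r)); first exact: I.
by rewrite /F pickleK B0; exact: set_mem.
Qed.

Hypothesis mu_moments : finite_moments mu.
Hypothesis mu_infinite : infinite_set (msupport mu).

Lemma msupport_nonroot (f : {poly R}) : f != 0 ->
  exists2 x, msupport mu x & ~~ root f x.
Proof.
move=> f0; have [B BS sB] := (infinite_set_fsetP _).1 mu_infinite (size f).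
have [/allP rB|] := boolP (all (root f) (finmap.enum_fset B)).
  have := max_poly_roots f0 (introT allP rB) (finmap.fset_uniq B).
  by rewrite ltnNge sB.
by move=> /allPn[x xB fx]; exists x => //; exact: BS.
Qed.

(** If the integral were 0, then f would vanish almost everywhere; but the open
    set where f is nonzero meets the support, hence has positive measure. *)
Lemma moment_functional_gt0 (f : {poly R}) : f != 0 ->
  (forall x, msupport mu x -> 0 <= f.[x]) -> 0 < \int[mu]_x f.[x].
Proof.
move=> f0 f_ge0.
have fi := integrable_poly mu_moments f.
have mf := measurable_int _ fi.
have fabs : (\int[mu]_x (f.[x])%:E = \int[mu]_x `|(f.[x])%:E|)%E.
  apply: ae_eq_integral => //; first exact: measurableT_comp.
  apply: negligibleS msupport_setC_negligible => x /= nx; apply: contra_not nx.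
  by move=> /f_ge0 fx _; rewrite ger0_norm.
have ge0 : 0 <= \int[mu]_x f.[x].
  by rewrite /Rintegral fabs fine_ge0// integral_ge0.
rewrite lt_neqAle ge0 andbT eq_sym; apply/negP => /eqP int0.
have : (\int[mu]_x `|(f.[x])%:E| = 0)%E.
  rewrite -fabs -[LHS]fineK; last exact: integrable_fin_num.
  by move: int0; rewrite /Rintegral => ->.
move/(ae_eq_integral_abs mu measurableT mf) => [A [mA A0 fA]].
have [x Sx fx] := msupport_nonroot f0.
have fO : open [set x | f.[x] != 0].
  rewrite (_ : [set _ | _] = horner f @^-1` [set y | y != 0])//.
  by apply: open_comp; [move=> y _; exact: continuous_horner|exact: open_neq].
have : (0 < mu [set x | f.[x] != 0]%R)%E by exact: Sx.
rewrite lt0e => /andP[/eqP + _]; apply.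
apply/eqP; rewrite -measure_le0 -A0 le_measure ?inE//; last first.
  by move=> y /= fy; apply: fA => /= /(_ I)[] /eqP; exact/negP.
exact: open_measurable fO.
Qed.
End support.

Lemma monic_orthogonal_seq (R : realType) (nu : borel_measure R)
    (L : {scalar {poly R}}) (p : nat -> {poly R}) :
  (forall f g, inner nu f g = L (f * g)) ->
  monic_orthogonal nu p -> orthogonal_seq L p.
Proof. by move=> LE [pm ps po]; split=> // k l kl; rewrite -LE po. Qed.

Theorem corollary1 (R : realType) (mu : borel_measure R)
    (p pss : nat -> {poly R}) (pN : {nonneg R} -> nat -> {poly R})
    (xi a : R) (eta : \bar R) (n : nat)
    (mu_moments : finite_moments mu)
    (mu_support : infinite_set (msupport mu))
    (hull_support : convex_hull (msupport mu)
                    = [set x : R | (xi%:E <= x%:E <= eta)%E])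
    (a_lt_xi : a < xi)
    (n_ge1 : (1 <= n)%N)
    (p_orth : monic_orthogonal mu p)
    (pss_orth : monic_orthogonal (christoffel mu a) pss)
    (pN_orth : forall N : {nonneg R}, monic_orthogonal (uvarov mu a N) (pN N)) :
  let N0 := - (p n).[xi] /
    (cd_kernel mu p n.-1 a a * (xi - a) * (pss n.-1).[xi]) in
  0 < N0 /\
  forall (N : {nonneg R}) (x : R), smallest_zero (pN N n) x ->
    [/\ N%:num < N0 -> xi < x,
        N%:num = N0 -> x = xi
      & N0 < N%:num -> x < xi].
Proof.
case: n n_ge1 => // n _ /=.
pose L : {scalar {poly R}} := moment_functional mu_moments.
have LE f g : inner mu f g = L (f * g).
  by apply: eq_Rintegral => x _; rewrite hornerM.
have L'E f g : inner (christoffel mu a) f g = christoffel_functional L a (f * g).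
  rewrite /inner Rintegral_christoffel.
    by apply: eq_Rintegral => x _; rewrite !hornerM hornerXsubC.
  apply: measurable_funM; exact: measurable_poly.
have ME N f g :
    inner (uvarov mu a N) f g = uvarov_functional L a N%:num (f * g).
  rewrite /inner Rintegral_uvarov; last first.
    rewrite (_ : _ \o _ = fun x => (f * g).[x]%:E); first exact: integrable_poly.
    by apply/funext => x /=; rewrite hornerM.
  rewrite /uvarov_functional hornerM; congr (_ + _).
  by apply: eq_Rintegral => x _; rewrite hornerM.
have L_pos : positive_on_ray L xi.
  move=> f f0 f_ge0; apply: moment_functional_gt0 => // x Sx; apply: f_ge0.
  have : convex_hull (msupport mu) x by exact: sub_smallest Sx.
  by rewrite hull_support /= lee_fin => /andP[].
have -> : cd_kernel mu p n a a = (kernel_poly L p a n).[a].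
  rewrite /cd_kernel /kernel_poly horner_sum; apply: eq_bigr => j _.
  by rewrite hornerZ /sqnorm LE mulrAC.
have [N0_gt0 zeroP] := uvarov_smallest_zero n L_pos
  (monic_orthogonal_seq LE p_orth) (monic_orthogonal_seq L'E pss_orth) a_lt_xi.
split=> [|N x]; first exact: N0_gt0.
have Q_orth := monic_orthogonal_seq (ME N) (pN_orth N).
have [Qm Qs _] := Q_orth.
by apply: zeroP => //; exact: orthogonal_seq_below.
Qed.
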